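(* There exist two countable groups that are isotypic (as structures in the first-order language of groups) but not isomorphic.
   Context: Let $\mathcal L$ be a first-order language and $A$ an $\mathcal L$-structure. For a finite tuple $\bar a=(a_1,\ldots,a_k)$ of elements of $A$, the type $\mathrm{tp}_A(\bar a)$ is the set of all first-order $\mathcal L$-formulas (without parameters) in $k$ free variables that hold in $A$ at $\bar a$. Two $\mathcal L$-structures $A$ and $B$ are isotypic if for every finite tuple $\bar a=(a_1,\ldots,a_k)$ over $A$ there is a tuple $\bar b=(b_1,\ldots,b_k)$ over $B$ of the same length with $\mathrm{tp}_A(\bar a)=\mathrm{tp}_B(\bar b)$, and vice versa (for every finite tuple over $B$ there is a tuple over $A$ of the same length with the same type). *)

(* Defs.v *)
From mathcomp Require Import all_boot.
From mathcomp Require Import boolp classical_sets functions cardinality.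

Set Implicit Arguments.
Unset Strict Implicit.
Unset Printing Implicit Defensive.

Local Open Scope classical_set_scope.

Record language := Language {
  fsymbol : Type;
  farity : fsymbol -> nat;
  rsymbol : Type;
  rarity : rsymbol -> nat
}.

Record structure (L : language) := Structure {
  carrier :> Type;
  finterp : forall s : fsymbol L, (farity s).-tuple carrier -> carrier;
  rinterp : forall r : rsymbol L, (rarity r).-tuple carrier -> Prop
}.

(* Terms and formulas with free variables among x_0, ..., x_{k-1}. *)
Inductive term (L : language) (k : nat) : Type :=
| TVar of 'I_k
| TApp (s : fsymbol L) of ('I_(farity s) -> term L k).

(* De Bruijn style binding: under a quantifier, x_0 is the bound variable and
   the outer x_i becomes x_{i+1}. *)
Inductive formula (L : language) : nat -> Type :=
| FEq k of term L k & term L k : formula L k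
| FRel k (r : rsymbol L) of ('I_(rarity r) -> term L k) : formula L k
| FNot k of formula L k : formula L k
| FAnd k of formula L k & formula L k : formula L k
| FOr k of formula L k & formula L k : formula L k
| FImp k of formula L k & formula L k : formula L k
| FForall k of formula L k.+1 : formula L k
| FExists k of formula L k.+1 : formula L k.

Fixpoint teval (L : language) (A : structure L) (k : nat) (a : k.-tuple A)
    (t : term L k) : A :=
  match t with
  | TVar i => tnth a i
  | TApp s ts => finterp [tuple teval a (ts i) | i < farity s]
  end.

Fixpoint sat (L : language) (A : structure L) (k : nat) (phi : formula L k) :
    k.-tuple A -> Prop :=
  match phi in formula _ k return k.-tuple A -> Prop with
  | FEq _ t u => fun a => teval a t = teval a u
  | FRel _ r ts => fun a => rinterp [tuple teval a (ts i) | i < rarity r]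
  | FNot _ p => fun a => ~ sat p a
  | FAnd _ p q => fun a => sat p a /\ sat q a
  | FOr _ p q => fun a => sat p a \/ sat q a
  | FImp _ p q => fun a => sat p a -> sat q a
  | FForall _ p => fun a => forall x : A, sat p [tuple of x :: a]
  | FExists _ p => fun a => exists x : A, sat p [tuple of x :: a]
  end.

Definition tp (L : language) (A : structure L) (k : nat) (a : k.-tuple A) :
    set (formula L k) :=
  [set phi | sat phi a].

Definition isotypic (L : language) (A B : structure L) : Prop :=
  (forall (k : nat) (a : k.-tuple A), exists b : k.-tuple B, tp a = tp b) /\
  (forall (k : nat) (b : k.-tuple B), exists a : k.-tuple A, tp a = tp b).

Inductive group_symbol := GMul | GInv | GOne.

Definition group_arity (s : group_symbol) : nat :=
  match s with GMul => 2 | GInv => 1 | GOne => 0 end.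

Definition group_language : language :=
  @Language group_symbol group_arity Empty_set (fun r => match r with end).

Definition group_finterp (G : groupType) (s : group_symbol) :
    (group_arity s).-tuple G -> G :=
  match s return (group_arity s).-tuple G -> G with
  | GMul => fun t => ([tnth t 0] * [tnth t 1])%g
  | GInv => fun t => ([tnth t 0]^-1)%g
  | GOne => fun _ => 1%g
  end.

Definition group_structure (G : groupType) : structure group_language :=
  @Structure group_language G (@group_finterp G) (fun r => match r with end).

Definition isomorphic_groups (G H : groupType) : Prop :=
  exists f : {multiplicative G -> H}, bijective f.

(* Main.v *)
From HB Require Import structures.
Require Import Defs.
From mathcomp Require Import all_boot all_order all_algebra.
From mathcomp Require Import boolp classical_sets functions cardinality.
From mathcomp Require Import zify ring.

Set Implicit Arguments.
Unset Strict Implicit.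
Unset Printing Implicit Defensive.

Import Order.TTheory GRing.Theory Num.Theory.

Local Open Scope ring_scope.

(** Fix a 2-adic unit t that is transcendental over the rationals, and let the
    groups be the additive groups of the 2-integral elements of Q[t] and of
    Q[t, 1/t], two subspaces of the field of 2-adic numbers.

    Isotypic: any finite tuple of Q[t, 1/t] is carried into Q[t] by
    multiplication by a high power of t, and multiplication by t does not change
    the type of a tuple.  The reason is a quantifier elimination for the groups
    that look like the localization of the integers at 2 ([dyadic]: torsion
    free, divisible by odd numbers, with exactly two classes modulo 2).  In such
    a group every element is, modulo 2^N, an integer multiple of any fixed
    element outside the double of the group ([dyadic_residue]).  Two tuples
    [agree] to precision N when they satisfy the same integer linear relations
    with coefficients at most N and have, modulo 2^N, the same integer
    coordinates over suitable generators.  Agreement to a high precision can be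
    prolonged by one more element with a lower precision ([agree_extend]), so
    by induction every formula is decided by some finite precision
    ([sat_agree]).  Multiplication by a power of the unit t keeps all relations
    and sends the generator 1 to another generator, hence preserves agreement to
    every precision ([tp_mul_monomial]).

    Not isomorphic: a homomorphism is compatible with congruences modulo 2^N,
    and integers are dense, so it is multiplication by a constant c
    ([hom_is_scaling]).  If c Q[t] contained c / t, then 1/t would be a
    polynomial in t, against the transcendence of t.

    The number t is the limit of the integers [approx n], and an element f(t) is
    encoded by the sequence of rationals f (approx n); congruences between
    2-adic numbers become congruences that hold for all large n.  The gaps
    [approx n.+1 - approx n = 2 ^ (approx n ^ n)] are powers of 2 that outgrow
    every polynomial in [approx n]; this gives convergence and, as in
    Liouville's construction, transcendence ([laurent_separated]). *)

(** * Groups resembling the localization of the integers at 2 *)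

Definition pow2_dvd (V : zmodType) (N : nat) (a : V) : Prop :=
  exists x : V, a = x *+ (2 ^ N)%N.

Record dyadic (V : zmodType) : Prop := Dyadic {
  dyadic_torsion_free : forall (a : V) n, (0 < n)%N -> a *+ n = 0 -> a = 0;
  dyadic_odd_div : forall (a : V) m, odd m -> exists b : V, a = b *+ m;
  dyadic_nontrivial : exists e : V, ~ pow2_dvd 1 e;
  dyadic_index2 : forall a b : V,
    ~ pow2_dvd 1 a -> ~ pow2_dvd 1 b -> pow2_dvd 1 (a - b)
}.

Lemma pow2_dvdD (V : zmodType) N (a b : V) :
  pow2_dvd N a -> pow2_dvd N b -> pow2_dvd N (a + b).
Proof. by move=> [x ->] [y ->]; exists (x + y); rewrite mulrnDl. Qed.

Lemma pow2_dvdN (V : zmodType) N (a : V) : pow2_dvd N a -> pow2_dvd N (- a).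
Proof. by move=> [x ->]; exists (- x); rewrite mulNrn. Qed.

Lemma pow2_dvdB (V : zmodType) N (a b : V) :
  pow2_dvd N a -> pow2_dvd N b -> pow2_dvd N (a - b).
Proof. by move=> ha hb; apply/pow2_dvdD/pow2_dvdN. Qed.

Lemma pow2_dvdBr (V : zmodType) N (a b : V) :
  pow2_dvd N (a - b) -> pow2_dvd N b -> pow2_dvd N a.
Proof. by move=> hab hb; rewrite -(subrK b a); apply: pow2_dvdD. Qed.

Lemma pow2_dvdZ (V : zmodType) N (a : V) (z : int) :
  pow2_dvd N a -> pow2_dvd N (a *~ z).
Proof. by move=> [x ->]; exists (x *~ z); rewrite !pmulrn -!mulrzA mulrC. Qed.

Lemma pow2_dvd_sum (V : zmodType) N (I : finType) (F : I -> V) :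
  (forall i, pow2_dvd N (F i)) -> pow2_dvd N (\sum_i F i).
Proof.
move=> h; apply: (big_ind (pow2_dvd N)) => //.
  by exists 0; rewrite mul0rn.
by move=> x y; exact: pow2_dvdD.
Qed.

Lemma pow2_dvdW (V : zmodType) N M (a : V) :
  (M <= N)%N -> pow2_dvd N a -> pow2_dvd M a.
Proof.
move=> le_MN [x ->]; exists (x *+ (2 ^ (N - M))).
by rewrite -mulrnA -expnD subnK.
Qed.

Lemma dyadic_mulrnI (V : zmodType) n (a b : V) :
  dyadic V -> (0 < n)%N -> a *+ n = b *+ n -> a = b.
Proof.
move=> dV n0 e; apply/eqP; rewrite -subr_eq0; apply/eqP.
by apply: (dyadic_torsion_free dV n0); rewrite mulrnBl e subrr.
Qed.

Lemma dyadic_mulrz_eq0 (V : zmodType) (z : int) (a : V) :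
  dyadic V -> z != 0 -> a *~ z = 0 -> a = 0.
Proof.
move=> dV; case: (intP z) => // n _; rewrite ?mulrNz => e;
  move: (@dyadic_torsion_free V dV a n.+1 isT) => h;
  apply: h => //.
by apply/eqP; rewrite -oppr_eq0; apply/eqP.
Qed.

(** The binary digits of [a] in base [e]: if the quotient found so far is not
    even, it becomes so after subtracting one more [e]. *)
Lemma dyadic_residue (V : zmodType) (e : V) :
  dyadic V -> ~ pow2_dvd 1 e ->
  forall a N, exists c : int, pow2_dvd N (a - e *~ c).
Proof.
move=> dV he a; elim=> [|N [c [x hx]]].
  by exists 0; exists a; rewrite mulr0z subr0.
case: (pselect (pow2_dvd 1 x)) => [[y hy]|hx'].
  by exists c, y; rewrite hx hy -mulrnA -expnD.
have [y hy] := dyadic_index2 dV hx' he.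
exists (c + (2 ^ N)%N%:Z), y.
rewrite mulrzDr opprD addrA hx -[e *~ _]/(e *+ _) -mulrnBl hy.
by rewrite -mulrnA -expnD.
Qed.

(** A generator behaves like the integer 1 with respect to powers of 2, which
    lets congruences be transported between two groups through the integers. *)
Lemma dyadic_generator_dvd (V : zmodType) (e : V) :
  dyadic V -> ~ pow2_dvd 1 e ->
  forall N (c : int), pow2_dvd N (e *~ c) <-> pow2_dvd N c.
Proof.
move=> dV he N c; split; last first.
  by move=> [d ->]; exists (e *~ d); rewrite !pmulrn -mulrzA;
    congr (_ *~ _); rewrite -mulrzr; lia.
elim: N c => [|N IHN] c [x hx]; first by exists c.
have [d [cd|cd]] : exists d : int, c = d *+ 2 \/ c = d *+ 2 + 1.
  exists (c %/ 2)%Z; lia.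
  move: hx; rewrite cd.
  have -> : e *~ (d *+ 2) = e *~ d *+ 2.
    by rewrite !pmulrn -mulrzA; congr (_ *~ _); lia.
  rewrite expnS mulnC mulrnA => /(dyadic_mulrnI dV (ltn0Sn 1)) hx'.
  have [|d' ->] := IHN d; first by exists x.
  by exists d'; rewrite expnS mulnC mulrnA.
case: he; exists (x *+ (2 ^ N) - e *~ d).
have {1}-> : e = x *+ (2 ^ N.+1) - e *~ (d *+ 2).
  by rewrite -hx cd mulrzDr mulr1z addrC addKr.
rewrite mulrnBl; congr (_ - _); first by rewrite -mulrnA expnS mulnC.
by rewrite !pmulrn -mulrzA; congr (_ *~ _); lia.
Qed.

Lemma pow2_split (z : int) : z != 0 -> exists (j m : nat),
  [/\ odd m, (j < `|z|)%N & z = (-1) ^+ (z < 0)%R * (m * 2 ^ j)%N%:Z].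
Proof.
move=> z0; have z0' : (0 < `|z|)%N by rewrite absz_gt0.
have [m hm ez] := pfactor_coprime (isT : prime 2) z0'.
exists (logn 2 `|z|), m; split.
- by rewrite -coprime2n.
- rewrite {2}ez; apply: (leq_trans (ltn_expl _ (isT : (1 < 2)%N))).
  by rewrite leq_pmull //; case: (m) hm.
- by rewrite -ez {1}[z]intEsign.
Qed.

Lemma dyadic_odd_cancel (V : zmodType) N m (a : V) :
  dyadic V -> odd m -> pow2_dvd N (a *+ m) -> pow2_dvd N a.
Proof.
move=> dV om [x hx]; have [y hy] := dyadic_odd_div dV x om.
exists y; apply: (@dyadic_mulrnI _ m _ _ dV); first by case: m om {hx hy}.
by rewrite hx hy -!mulrnA mulnC.
Qed.

(** Only the 2-part [2 ^ j] of a multiplier matters.  The bound on [j] and its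
    independence of the group are what makes the loss of precision uniform. *)
Lemma dyadic_mulz (z : int) : z != 0 ->
  exists2 j : nat, (j < `|z|)%N & forall V : zmodType, dyadic V ->
    (forall N (a : V), pow2_dvd (N + j) (a *~ z) <-> pow2_dvd N a) /\
    (forall a : V, pow2_dvd j a -> exists y, y *~ z = a).
Proof.
move=> /pow2_split[j [m [om jz ez]]]; exists j => // V dV.
have mul_z (a : V) : a *~ z = (a *+ m *+ 2 ^ j) *~ ((-1) ^+ (z < 0)%R).
  by rewrite {1}ez mulrC mulrzA -pmulrn mulrnA.
have signK (a : V) : a *~ ((-1) ^+ (z < 0)%R) *~ ((-1) ^+ (z < 0)%R) = a.
  by rewrite -mulrzA -expr2 sqrr_sign mulr1z.
split=> [N a|a [x ->]].
  split=> [/(pow2_dvdZ ((-1) ^+ (z < 0)%R))|[x ->]].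
    rewrite mul_z signK => -[x]; rewrite expnD mulrnA.
    move=> /(dyadic_mulrnI dV); rewrite expn_gt0 => /(_ isT) hx.
    by apply: (dyadic_odd_cancel dV om); exists x.
  rewrite mul_z; apply: pow2_dvdZ; exists (x *+ m).
  by rewrite -!mulrnA; congr (_ *+ _); rewrite expnD; lia.
have [y ->] := dyadic_odd_div dV x om.
exists (y *~ ((-1) ^+ (z < 0)%R)); rewrite mul_z !pmulrn -!mulrzA.
congr (_ *~ _).
transitivity (((-1) ^+ (z < 0)%R) ^+ 2 * (m%:Z * (2 ^ j)%N%:Z)); first by ring.
by rewrite sqrr_sign mul1r.
Qed.

(** * Finite agreement of tuples *)

Definition comb (V : zmodType) k (a : k.-tuple V) (z : 'I_k -> int) : V :=
  \sum_i tnth a i *~ z i.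

Definition bounded k (N : nat) (z : 'I_k -> int) : Prop :=
  forall i, (`|z i| <= N)%N.

(** The coordinates [c] are shared but the generators are not: tuples that
    differ by multiplication by a 2-adic unit are meant to agree. *)
Definition agree (A B : zmodType) k (N : nat)
    (a : k.-tuple A) (b : k.-tuple B) : Prop :=
  (forall z, bounded N z -> comb a z = 0 <-> comb b z = 0) /\
  exists (e : A) (f : B) (c : 'I_k -> int),
    [/\ ~ pow2_dvd 1 e, ~ pow2_dvd 1 f
      & forall i, pow2_dvd N (tnth a i - e *~ c i) /\
                  pow2_dvd N (tnth b i - f *~ c i)].

Lemma agree_sym (A B : zmodType) k N (a : k.-tuple A) (b : k.-tuple B) :
  agree N a b -> agree N b a.
Proof.
move=> [h [e [f [c [he hf hc]]]]]; split; first by move=> z /h [].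
by exists f, e, c; split=> // i; have [] := hc i.
Qed.

Lemma agreeW (A B : zmodType) k N M (a : k.-tuple A) (b : k.-tuple B) :
  (M <= N)%N -> agree N a b -> agree M a b.
Proof.
move=> leMN [h [e [f [c [he hf hc]]]]]; split.
  by move=> z bz; apply: h => i; apply: leq_trans leMN.
exists e, f, c; split=> // i; have [h1 h2] := hc i.
by split; apply: pow2_dvdW leMN _.
Qed.

Lemma combB (V : zmodType) k (a : k.-tuple V) (y z : 'I_k -> int) :
  comb a (fun i => y i - z i) = comb a y - comb a z.
Proof. by rewrite /comb -sumrB; apply: eq_bigr => i _; rewrite mulrzBr. Qed.

Lemma combZ (V : zmodType) k (a : k.-tuple V) (z : 'I_k -> int) m :
  comb a (fun i => z i * m) = comb a z *~ m.
Proof.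
by rewrite /comb mulrz_suml; apply: eq_bigr => i _; rewrite mulrzA.
Qed.

Lemma comb_cons (V : zmodType) k (x : V) (a : k.-tuple V) z :
  comb [tuple of x :: a] z
    = x *~ z ord0 + comb a (fun i => z (lift ord0 i)).
Proof.
rewrite /comb big_ord_recl; congr (_ + _).
by apply: eq_bigr => i _; rewrite tnthS.
Qed.

Lemma comb_residue (V : zmodType) k N (a : k.-tuple V) (e : V) c z :
  (forall i, pow2_dvd N (tnth a i - e *~ c i)) ->
  pow2_dvd N (comb a z - e *~ (\sum_i c i * z i)).
Proof.
move=> h; rewrite mulrz_sumr -sumrB; apply: pow2_dvd_sum => i.
by rewrite mulrzA -mulrzBl; apply: pow2_dvdZ.
Qed.

Lemma eventually_finite (I : finType) (P : I -> nat -> Prop) :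
  (forall i, exists R, forall r, (R <= r)%N -> P i r) ->
  exists r, forall i, P i r.
Proof.
move=> h; have [R hR] := choice h.
by exists (\max_i R i)%N => i; apply: hR; apply: leq_bigmax.
Qed.

(** Boundedness leaves finitely many coefficient vectors, so finitely many
    conditions, each true for large [r], hold for a common [r]. *)
Lemma bounded_eventually k N (P : ('I_k -> int) -> nat -> Prop) :
  (forall z, bounded N z -> exists R, forall r, (R <= r)%N -> P z r) ->
  exists r, forall z, bounded N z -> P z r.
Proof.
move=> h; pose dec (g : {ffun 'I_k -> 'I_(N + N).+1}) i := (g i)%:Z - N%:Z.
have bdec g : bounded N (dec g).
  by move=> i; rewrite /dec; have := ltn_ord (g i); lia.
have [r hr] := @eventually_finite _ (fun g => P (dec g)) (fun g => h _ (bdec g)).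
exists r => z bz; have := hr [ffun i => inord `|z i + N%:Z|].
congr P; apply/funext => i; rewrite /dec ffunE inordK; have := bz i; lia.
Qed.

(** A nonzero multiple of the first entry is determined by a relation, so each
    relation excludes at most one element of the progression [y + w *+ r]. *)
Lemma fresh_element (B : zmodType) k N (b : k.-tuple B) (y w : B) :
  dyadic B -> w != 0 ->
  exists r : nat, forall z : 'I_k.+1 -> int, bounded N z -> z ord0 != 0 ->
    comb [tuple of (y + w *+ r) :: b] z <> 0.
Proof.
move=> dB w0.
apply: (@bounded_eventually _ _ (fun z r => z ord0 != 0 ->
   comb [tuple of (y + w *+ r) :: b] z <> 0)) => z _.
case: (pselect (exists r, z ord0 != 0 /\ comb [tuple of (y + w *+ r) :: b] z = 0));
  last first.
  by move=> h; exists 0%N => r _ z0 hr; apply: h; exists r.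
move=> [R [z0 hR]]; exists R.+1 => r ltRr _ hr; move/eqP: w0; apply.
apply: (@dyadic_torsion_free _ dB _ (r - R)); first by rewrite subn_gt0.
apply: (@dyadic_mulrz_eq0 _ (z ord0) _ dB z0).
rewrite mulrnBr 1?ltnW //.
have -> : w *+ r - w *+ R = (y + w *+ r) - (y + w *+ R)
  by rewrite opprD addrACA subrr add0r.
rewrite mulrzBl.
move: (etrans hr (esym hR)); rewrite !comb_cons => /addIr ->; exact: subrr.
Qed.

(** One round of the Ehrenfeucht-Fraisse game.  If [x] satisfies a bounded
    relation [x *~ m = - comb a z'], then [y] must solve the corresponding
    equation over [b]: solvability is a congruence modulo the 2-part of [m], and
    any other bounded relation for [x] is, after elimination of [x], a relation
    between the entries of [a] with coefficients at most [2 * N ^ 2].  If [x]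
    satisfies none, any [y] with the right residue that avoids finitely many
    values will do. *)
Lemma agree_extend (A B : zmodType) k N (a : k.-tuple A) (b : k.-tuple B) :
  dyadic A -> dyadic B -> agree (2 * N ^ 2 + 2 * N) a b ->
  forall x : A, exists y : B, agree N [tuple of x :: a] [tuple of y :: b].
Proof.
set M := (2 * N ^ 2 + 2 * N)%N.
move=> dA dB [rel [e [f [c [he hf hc]]]]] x.
have leNM : (N <= M)%N by rewrite /M; lia.
have [g hg] := dyadic_residue dA he x N.
pose c' (i : 'I_k.+1) := oapp c g (unlift ord0 i).
have residues (y : B) : pow2_dvd N (y - f *~ g) ->
    exists (e : A) (f : B) (c : 'I_k.+1 -> int),
    [/\ ~ pow2_dvd 1 e, ~ pow2_dvd 1 f
      & forall i, pow2_dvd N (tnth [tuple of x :: a] i - e *~ c i) /\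
                  pow2_dvd N (tnth [tuple of y :: b] i - f *~ c i)].
  move=> hy; exists e, f, c'; split => // i; rewrite /c'.
  case: (unliftP ord0 i) => [j|] -> /=; last by rewrite !tnth0.
  by rewrite !tnthS; have [h1 h2] := hc j; split; apply: pow2_dvdW leNM _.
case: (pselect (exists z : 'I_k.+1 -> int,
   [/\ bounded N z, z ord0 != 0 & comb [tuple of x :: a] z = 0])).
- move=> [z [bz z0]]; pose z' i := z (lift ord0 i).
  rewrite comb_cons -/z' => relx.
  have [j ltj dj] := dyadic_mulz z0.
  have [mulA _] := dj _ dA; have [mulB divB] := dj _ dB.
  have leNj : (N + j <= M)%N by have := bz ord0; rewrite /M; lia.
  have lejM : (j <= M)%N by lia.
  have hx : x *~ z ord0 = - comb a z' by apply/eqP; rewrite -addr_eq0 relx.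
  pose C := \sum_i c i * z' i.
  have resA := comb_residue z' (fun i => proj1 (hc i)); rewrite -/C in resA.
  have resB := comb_residue z' (fun i => proj2 (hc i)); rewrite -/C in resB.
  have [y hy] : exists y, y *~ z ord0 = - comb b z'.
    apply: divB; apply/pow2_dvdN/(pow2_dvdBr (pow2_dvdW lejM resB)).
    apply/(dyadic_generator_dvd dB hf)/(dyadic_generator_dvd dA he).
    (* [comb a z'] is divisible by [2 ^ j] as it is a multiple of [x *~ m]. *)
    rewrite -(subKr (comb a z') (e *~ C)).
    apply/pow2_dvdB/(pow2_dvdW lejM resA).
    by rewrite -[comb a z']opprK -hx; apply/pow2_dvdN/(mulA 0%N); exists x.
  have relE z2 : bounded N z2 -> (comb [tuple of x :: a] z2 = 0 <->
                                 comb [tuple of y :: b] z2 = 0).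
    move=> bz2; pose w i := z2 (lift ord0 i) * z ord0 - z' i * z2 ord0.
    have bw : bounded M w.
      move=> i; rewrite /w /z' /M.
      have := bz2 (lift ord0 i); have := bz2 ord0.
      have := bz (lift ord0 i); have := bz ord0.
      move: (z2 _) (z _) (z2 _) (z _) => p q r s; nia.
    (* Eliminating the first entry between the relations [z] and [z2]. *)
    have key (V : zmodType) (u : V) (v : k.-tuple V) : dyadic V ->
        u *~ z ord0 = - comb v z' ->
        (comb [tuple of u :: v] z2 = 0 <-> comb v w = 0).
      move=> dV hu; rewrite comb_cons.
      have -> : comb v w =
          (u *~ z2 ord0 + comb v (fun i => z2 (lift ord0 i))) *~ z ord0.
        rewrite /w combB !combZ mulrzDl -mulrzA mulrC mulrzA hu.
        by rewrite mulNrz addrC.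
      split=> [->|]; first by rewrite mul0rz.
      exact: dyadic_mulrz_eq0.
    by rewrite (key _ _ _ dA hx) (key _ _ _ dB hy); apply: rel.
  exists y; split=> //; apply: residues.
  apply/mulB; rewrite mulrzBl hy -mulrzA.
  (* The congruence between [C] and [- g * z ord0] is read off from [a]
     through [e], and used over [b] through [f]. *)
  have : pow2_dvd (N + j) (f *~ (C + g * z ord0)).
    apply/(dyadic_generator_dvd dB hf)/(dyadic_generator_dvd dA he).
    rewrite mulrzDr mulrzA.
    have -> : e *~ C + e *~ g *~ z ord0 =
      - ((comb a z' - e *~ C) + (x - e *~ g) *~ z ord0).
      by rewrite mulrzBl hx (addrC (comb a z')) addrA addrK -opprD opprK.
    apply/pow2_dvdN/pow2_dvdD; first exact: pow2_dvdW leNj _.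
    exact/mulA.
  move=> /pow2_dvdN h.
  have := pow2_dvdB h (pow2_dvdW leNj resB).
  by rewrite mulrzDr opprD opprB addrC addrACA subrr add0r.
- move=> norel.
  have f0 : f *+ 2 ^ N != 0.
    apply/eqP => h; apply: hf; exists 0.
    rewrite mul0rn; apply: (dyadic_torsion_free dB _ h).
    by rewrite expn_gt0.
  have [r hr] := @fresh_element B k N b (f *~ g) _ dB f0.
  exists (f *~ g + f *+ 2 ^ N *+ r); split; last first.
    by apply: residues; exists (f *+ r); rewrite addrC addKr -!mulrnA mulnC.
  move=> z bz; have [z0|z0] := eqVneq (z ord0) 0; last first.
    split=> h; first by case: norel; exists z.
    by case: (hr z).
  rewrite !comb_cons z0 !mulr0z !add0r; apply: rel => i.
  exact: leq_trans (bz _) leNM.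
Qed.

Lemma combN (V : zmodType) k (a : k.-tuple V) (z : 'I_k -> int) :
  comb a (fun i => - z i) = - comb a z.
Proof. by rewrite /comb -sumrN; apply: eq_bigr => i _; rewrite mulrNz. Qed.

(** * Types in dyadic groups *)

Notation additive_structure V :=
  (group_structure (GRing.to_multiplicative V)).

Lemma teval_comb k (t : term group_language k) :
  exists z : 'I_k -> int, forall (V : zmodType) (a : k.-tuple V),
    @teval _ (additive_structure V) _ a t = comb a z.
Proof.
elim: t => [i|s ts IH].
  exists (fun j => (j == i)%:Z) => V a /=.
  rewrite /comb (bigD1 i) //= eqxx mulr1z big1 ?addr0 // => j /negbTE ->.
  by rewrite mulr0z.
have [zs hzs] := choice IH.
case: s ts IH zs hzs => /= ts _ zs hzs.
- exists (fun i => zs (Ordinal (isT : 0 < 2)%N) i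
                    - (- zs (Ordinal (isT : 1 < 2)%N) i)) => V a.
  rewrite combB combN opprK /= !tnth_mktuple !hzs.
  by apply: (congr2 (@GRing.add V)); congr (comb a (zs _)); apply: val_inj.
- exists (fun i => - zs (Ordinal (isT : 0 < 1)%N) i) => V a.
  rewrite combN /= !tnth_mktuple !hzs.
  by apply: (congr1 (@GRing.opp V)); congr (comb a (zs _)); apply: val_inj.
- exists (fun _ => 0) => V a.
  by rewrite /comb big1 // => i _; rewrite mulr0z.
Qed.

Lemma sat_agree k (phi : formula group_language k) :
  exists N, forall (A B : zmodType) (a : k.-tuple A) (b : k.-tuple B),
    dyadic A -> dyadic B -> agree N a b ->
    (@sat _ (additive_structure A) _ phi a <->
     @sat _ (additive_structure B) _ phi b).
Proof.
have quantifier j (p : formula group_language j.+1) :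
    (exists N, forall (A B : zmodType) (a : j.+1.-tuple A) (b : j.+1.-tuple B),
      dyadic A -> dyadic B -> agree N a b ->
      (@sat _ (additive_structure A) _ p a <->
       @sat _ (additive_structure B) _ p b)) ->
    exists N, forall (A B : zmodType) (a : j.-tuple A) (b : j.-tuple B),
      dyadic A -> dyadic B -> agree N a b -> forall x, exists y,
      (@sat _ (additive_structure A) _ p [tuple of x :: a] <->
       @sat _ (additive_structure B) _ p [tuple of y :: b]).
  move=> [N IH]; exists (2 * N ^ 2 + 2 * N)%N => A B a b dA dB ab x.
  have [y hy] := agree_extend dA dB ab x.
  by exists y; apply: IH.
elim: phi => {k}
  [k t u|k []//|k p [N IH]|k p [N IHp] q [M IHq]|k p [N IHp] q [M IHq]
  |k p [N IHp] q [M IHq]|k p /quantifier[N IH]|k p /quantifier[N IH]].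
- have [z hz] := teval_comb t; have [w hw] := teval_comb u.
  pose d i := z i - w i.
  exists (\max_i `|d i|)%N => A B a b dA dB [rel _] /=.
  rewrite !hz !hw.
  have bd : bounded (\max_i `|d i|)%N d by move=> i; apply: leq_bigmax.
  have := rel _ bd; rewrite /d !combB.
  have subE (V : zmodType) (x y : V) : x - y = 0 <-> x = y.
    by split=> [/subr0_eq|->]; rewrite ?subrr.
  by rewrite !subE.
- by exists N => A B a b dA dB ab /=; have := IH A B a b dA dB ab; tauto.
- exists (maxn N M) => A B a b dA dB ab /=.
  have := IHp A B a b dA dB (agreeW (leq_maxl _ _) ab).
  by have := IHq A B a b dA dB (agreeW (leq_maxr _ _) ab); tauto.
- exists (maxn N M) => A B a b dA dB ab /=.
  have := IHp A B a b dA dB (agreeW (leq_maxl _ _) ab).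
  by have := IHq A B a b dA dB (agreeW (leq_maxr _ _) ab); tauto.
- exists (maxn N M) => A B a b dA dB ab /=.
  have := IHp A B a b dA dB (agreeW (leq_maxl _ _) ab).
  by have := IHq A B a b dA dB (agreeW (leq_maxr _ _) ab); tauto.
- exists N => A B a b dA dB ab /=; split=> h x.
    by have [y hy] := IH B A b a dB dA (agree_sym ab) x; apply/hy.
  by have [y hy] := IH A B a b dA dB ab x; apply/hy.
- exists N => A B a b dA dB ab /=; split=> -[x hx].
    by have [y hy] := IH A B a b dA dB ab x; exists y; apply/hy.
  by have [y hy] := IH B A b a dB dA (agree_sym ab) x; exists y; apply/hy.
Qed.

Lemma tp_eq_agree (A B : zmodType) k (a : k.-tuple A) (b : k.-tuple B) :
  dyadic A -> dyadic B -> (forall N, agree N a b) ->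
  @tp _ (additive_structure A) _ a = @tp _ (additive_structure B) _ b.
Proof.
move=> dA dB h; apply/funext => phi; apply/propext.
by have [N hN] := sat_agree phi; apply: hN.
Qed.

(** * Congruences modulo powers of 2 in the rationals *)

(** [x] is [2 ^ N] times a rational with odd denominator, that is, its 2-adic
    valuation is at least [N]. *)
Definition close (N : nat) (x : rat) : Prop :=
  exists (m : nat) (k : int), odd m /\ x * m%:R = k%:~R * 2 ^+ N.

Lemma odd_rat_neq0 m : odd m -> m%:R != 0 :> rat.
Proof. by case: m => // m _; rewrite pnatr_eq0. Qed.

Lemma close_int (k : int) : close 0 k%:~R.
Proof. by exists 1%N, k; rewrite expr0 !mulr1. Qed.

Lemma closeD N x y : close N x -> close N y -> close N (x + y).
Proof.
move=> [m [k [om hm]]] [n [l [on hn]]].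
exists (m * n)%N, (k * n%:Z + l * m%:Z); split; first by rewrite oddM om.
rewrite natrM rmorphD !rmorphM /= -!pmulrn.
transitivity (x * m%:R * n%:R + y * n%:R * m%:R); first by ring.
by rewrite hm hn; ring.
Qed.

Lemma closeM M N x y : close M x -> close N y -> close (M + N) (x * y).
Proof.
move=> [m [k [om hm]]] [n [l [on hn]]].
exists (m * n)%N, (k * l); split; first by rewrite oddM om.
by rewrite natrM mulrACA hm hn exprD rmorphM /=; ring.
Qed.

Lemma closeZ N (k : int) x : close N x -> close N (x * k%:~R).
Proof. by move=> h; rewrite -[N]addn0; apply: closeM h (close_int k). Qed.

Lemma closeN N x : close N x -> close N (- x).
Proof. by move=> /(closeZ (-1)); rewrite mulrN1. Qed.

Lemma closeB N x y : close N x -> close N y -> close N (x - y).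
Proof. by move=> hx hy; apply/closeD/closeN. Qed.

Lemma close_pow2M N M x : close (N + M) (x * 2 ^+ M) <-> close N x.
Proof.
split=> -[m [k [om hk]]]; exists m, k; split=> //; last first.
  by rewrite exprD mulrAC hk mulrA.
have e : (2 ^+ M : rat) != 0 by rewrite expf_neq0.
by apply: (mulIf e); rewrite mulrAC hk exprD mulrA.
Qed.

Lemma closeW N M x : (M <= N)%N -> close N x -> close M x.
Proof.
move=> leMN [m [k [om hk]]]; exists m, (k * 2 ^+ (N - M)); split => //.
by rewrite hk rmorphM rmorphXn /= -mulrA -exprD subnK.
Qed.

Lemma close_oddM N m x : odd m -> close N (x * m%:R) <-> close N x.
Proof.
move=> om; split=> [[n [k [on hk]]]|]; last by rewrite pmulrn; apply: closeZ.
exists (m * n)%N, k; split; first by rewrite oddM om.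
by rewrite natrM mulrA.
Qed.

Lemma close_mulz (z : int) : z != 0 ->
  exists j, forall N x, close (N + j) (x * z%:~R) -> close N x.
Proof.
move=> /pow2_split[j [m [om _ ez]]]; exists j => N x.
move/(closeZ ((-1) ^+ (z < 0)%R)); rewrite -mulrA -rmorphM /=.
have -> : z * (-1) ^+ (z < 0)%R = (m * 2 ^ j)%N%:Z.
  by rewrite {1}ez mulrAC -expr2 sqrr_sign mul1r.
rewrite -pmulrn natrM natrX mulrA => /close_pow2M.
by move/(close_oddM _ _ om).
Qed.

Lemma close_intP N (k : int) : close N k%:~R <-> pow2_dvd N k.
Proof.
split=> [[m [l [om hl]]]|[d ->]]; last first.
  by exists 1%N, d; rewrite mulr1 rmorphMn /= -mulr_natr natrX.
have {}hl : k * m%:Z = l * (2 ^ N)%N%:Z.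
  by apply/(@intr_inj rat); rewrite !rmorphM /= hl -!pmulrn natrX.
have : ((2 ^ N)%N%:Z %| k * m%:Z)%Z by rewrite hl dvdz_mull.
rewrite Gauss_dvdzl; first by move=> /dvdzP[d ->]; exists d; rewrite -mulr_natr natz.
by rewrite coprimezE coprimeXl ?coprime2n.
Qed.

Lemma close_index2 x y :
  close 0 x -> close 0 y -> ~ close 1 x -> ~ close 1 y -> close 1 (x - y).
Proof.
have even_or_odd (k : int) : exists d : int, k = d * 2 \/ k = d * 2 + 1.
  by exists (k %/ 2)%Z; lia.
move=> [m [k [om hm]]] [n [l [on hn]]] hx hy.
have [d [kd|kd]] := even_or_odd k.
  by case: hx; exists m, d; rewrite hm kd rmorphM /= expr0 mulr1.
have [d' [ld|ld]] := even_or_odd l.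
  by case: hy; exists n, d'; rewrite hn ld rmorphM /= expr0 mulr1.
apply/(close_oddM _ _ om)/(close_oddM _ _ on).
have -> : (x - y) * m%:R * n%:R = (k * n%:Z - l * m%:Z)%:~R.
  rewrite rmorphB !rmorphM /= -!pmulrn.
  transitivity (x * m%:R * n%:R - y * n%:R * m%:R); first by ring.
  by rewrite hm hn expr0 !mulr1.
apply/close_intP; exists ((k * n%:Z - l * m%:Z) %/ 2)%Z.
have [a em] : exists a, m = (a * 2 + 1)%N.
  by exists m./2; rewrite -{1}(odd_double_half m) om addnC muln2.
have [b en] : exists b, n = (b * 2 + 1)%N.
  by exists n./2; rewrite -{1}(odd_double_half n) on addnC muln2.
suff -> : k * n%:Z - l * m%:Z =
   (d * (b * 2 + 1)%N%:Z + b%:Z - d' * (a * 2 + 1)%N%:Z - a%:Z) * 2.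
  by rewrite mulzK //; lia.
by rewrite kd ld em en; lia.
Qed.

Lemma not_close1 : ~ close 1 1.
Proof.
move=> /(close_intP 1 1)[d]; rewrite expn1 => h; lia.
Qed.

(** * Integral parts of spaces of 2-adically convergent sequences *)

(** For a Cauchy sequence: its 2-adic limit has valuation at least [N]. *)
Definition near_close (N : nat) (s : nat -> rat) : Prop :=
  exists n0, forall n, (n0 <= n)%N -> close N (s n).

Lemma near_closeB N r s :
  near_close N r -> near_close N s -> near_close N (r - s).
Proof.
move=> [n0 h0] [n1 h1]; exists (maxn n0 n1) => n; rewrite geq_max => /andP[l0 l1].
exact: closeB (h0 n l0) (h1 n l1).
Qed.

Lemma near_closeM M N r s : near_close M r -> near_close N s ->
  near_close (M + N) (fun n => r n * s n).
Proof.
move=> [n0 h0] [n1 h1]; exists (maxn n0 n1) => n; rewrite geq_max => /andP[l0 l1].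
exact: closeM (h0 n l0) (h1 n l1).
Qed.

Definition cauchy2 (s : nat -> rat) : Prop :=
  forall N, exists n0, forall m n, (n0 <= m)%N -> (n0 <= n)%N ->
    close N (s m - s n).

(** A sequence of rationals stands for its 2-adic limit, so this is a rational
    subspace, containing 1, of the field of 2-adic numbers. *)
Record cauchy_space := CauchySpace {
  cs_mem :> (nat -> rat) -> Prop;
  cs_sub : forall r s, cs_mem r -> cs_mem s -> cs_mem (r - s);
  cs_scale : forall (q : rat) s, cs_mem s -> cs_mem (fun n => q * s n);
  cs_one : cs_mem (fun=> 1);
  cs_cauchy : forall s, cs_mem s -> cauchy2 s
}.

Definition integral_in (W : cauchy_space) : {pred (nat -> rat)} :=
  fun s => `[< W s /\ near_close 0 s >].

Lemma integral_in_zmod_closed W : zmod_closed (integral_in W).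
Proof.
split=> [|r s /asboolP[Wr ir] /asboolP[Ws is_]]; apply/asboolP; split.
- by have := cs_sub (cs_one W) (cs_one W); rewrite subrr.
- by exists 0%N => n _; apply: (close_int 0).
- exact: cs_sub.
- exact: near_closeB.
Qed.

HB.instance Definition _ W :=
  GRing.isZmodClosed.Build _ (integral_in W) (integral_in_zmod_closed W).

Record integral_part (W : cauchy_space) := IntegralPart {
  ip_val :> nat -> rat;
  _ : ip_val \in integral_in W
}.

HB.instance Definition _ W := [isSub for @ip_val W].
HB.instance Definition _ W := [Choice of integral_part W by <:].
HB.instance Definition _ W := [SubChoice_isSubZmodule of integral_part W by <:].

Section IntegralPart.
Variable W : cauchy_space.
Implicit Types s : integral_part W.

Lemma ip_mem s : W s. Proof. by case: s => s /= /asboolP[]. Qed.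

Lemma ip_integral s : near_close 0 s. Proof. by case: s => s /= /asboolP[]. Qed.

Lemma ip_exists r : W r -> near_close 0 r ->
  exists s, forall n, s n = r n.
Proof.
move=> Wr ir; have h : r \in integral_in W by apply/asboolP.
by exists (IntegralPart h).
Qed.

Lemma ipP s s' : (forall n, s n = s' n) -> s = s'.
Proof. by move=> h; apply: val_inj; apply/funext. Qed.

Lemma ip_mulrn s m n : (s *+ m) n = s n * m%:R.
Proof.
elim: m => [|m IH]; first by rewrite mulr0n mulr0.
by rewrite mulrS -natr1 mulrDr mulr1 -IH addrC.
Qed.

Lemma ip_mulrz s (z : int) n : (s *~ z) n = s n * z%:~R.
Proof.
case: z => m; first exact: ip_mulrn.
rewrite !NegzE !mulrNz mulrN -[in RHS]pmulrn -ip_mulrn; exact: erefl.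
Qed.

(** The ambient space is closed under division by [2 ^ N], so divisibility in
    the group is just a matter of valuation: the group is pure. *)
Lemma ip_dvdP N s : pow2_dvd N s <-> near_close N s.
Proof.
split=> [[r ->]|[n0 h]].
  have [n0 h] := ip_integral r; exists n0 => n /h hn.
  by rewrite ip_mulrn natrX; apply/(close_pow2M 0 N).
have p0 : (2 ^+ N : rat) != 0 by rewrite expf_neq0.
have [r hr] : exists r : integral_part W, forall n, r n = (2 ^+ N)^-1 * s n.
  apply: ip_exists; first exact/cs_scale/ip_mem.
  exists n0 => n /h hn; apply/(close_pow2M 0 N).
  by rewrite mulrC mulVKf.
exists r; apply: ipP => n; rewrite ip_mulrn hr natrX mulrC mulVKf //.
Qed.

(** The residue field of the 2-adic integers has two elements, and a Cauchy
    sequence of 2-integral rationals has an eventually constant residue. *)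
Lemma dyadic_integral_part : dyadic (integral_part W).
Proof.
split.
- move=> s [//|m] _ h; apply: ipP => n.
  have := congr1 (fun r : integral_part W => r n) h.
  by rewrite /= ip_mulrn => /eqP; rewrite mulf_eq0 pnatr_eq0 orbF => /eqP.
- move=> s m om; have m0 := odd_rat_neq0 om.
  have [r hr] : exists r : integral_part W, forall n, r n = m%:R^-1 * s n.
    apply: ip_exists; first exact/cs_scale/ip_mem.
    have [n0 h] := ip_integral s; exists n0 => n /h hn.
    by apply/(close_oddM _ _ om); rewrite mulrC mulVKf.
  by exists r; apply: ipP => n; rewrite ip_mulrn hr mulrC mulVKf.
- have [e he] : exists e : integral_part W, forall n, e n = 1.
    by apply: ip_exists (cs_one W) _; exists 0%N => n _; apply: (close_int 1).
  exists e => /ip_dvdP[n0 /(_ n0 (leqnn _))].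
  by rewrite he; apply: not_close1.
- have odd_tail s : ~ pow2_dvd 1 s ->
      exists n0, forall n, (n0 <= n)%N -> ~ close 1 (s n).
    move=> hs; have [n0 h] := cs_cauchy (ip_mem s) 1.
    exists n0 => n len hn; apply: hs; apply/ip_dvdP; exists n0 => m lem.
    by rewrite -(subrK (s n) (s m)); apply: closeD hn; apply: h.
  move=> r s /odd_tail[n0 h0] /odd_tail[n1 h1]; apply/ip_dvdP.
  have [n2 h2] := ip_integral r; have [n3 h3] := ip_integral s.
  exists (n0 + n1 + n2 + n3)%N => n len.
  apply: close_index2; [apply: h2|apply: h3|apply: h0|apply: h1]; lia.
Qed.

End IntegralPart.

(** * A transcendental 2-adic unit *)

Fixpoint approx (n : nat) : nat :=
  if n is m.+1 then (approx m + 2 ^ (approx m ^ m))%N else 1%N.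

Lemma approx_gt n : (n < approx n)%N.
Proof.
elim: n => //= n IH; have : (0 < 2 ^ (approx n ^ n))%N by rewrite expn_gt0.
lia.
Qed.

Lemma approx_gt0 n : (0 < approx n)%N.
Proof. exact: leq_ltn_trans (leq0n n) (approx_gt n). Qed.

Lemma approx_odd n : odd (approx n).
Proof.
by elim: n => //= n IH; rewrite oddD IH oddX orbF expn_eq0 eqn0Ngt approx_gt0.
Qed.

Lemma approx_ltS n : (approx n < approx n.+1)%N.
Proof. by rewrite /= -[X in (X < _)%N]addn0 ltn_add2l expn_gt0. Qed.

Lemma approx_mono : {mono approx : m n / (m <= n)%N}.
Proof. exact/leq_mono/(homo_ltn ltn_trans)/approx_ltS. Qed.

Lemma approx_dvd n m : (n <= m)%N ->
  ((2 ^ (approx n ^ n))%N%:Z %| (approx m)%:Z - (approx n)%:Z)%Z.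
Proof.
elim: m => [|m IH]; first by rewrite leqn0 => /eqP ->; rewrite subrr dvdz0.
rewrite leq_eqVlt => /orP[/eqP ->|]; first by rewrite subrr dvdz0.
rewrite ltnS => lenm; rewrite /= PoszD addrAC rpredD ?IH //.
apply: dvdn_exp2l; apply: (@leq_trans (approx m ^ n)).
  by case: n lenm {IH} => // n lenm; rewrite leq_exp2r // approx_mono.
by rewrite leq_pexp2l // approx_gt0.
Qed.

Lemma horner_dvd (q : {poly int}) (x y d : int) :
  (d %| x - y)%Z -> (d %| q.[x] - q.[y])%Z.
Proof.
move=> dxy; elim/poly_ind: q => [|q c IH]; first by rewrite !horner0 subrr dvdz0.
rewrite !hornerMXaddC.
have -> : q.[x] * x + c - (q.[y] * y + c) =
  (q.[x] - q.[y]) * x + q.[y] * (x - y) by ring.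
by apply: rpredD; [apply: dvdz_mulr|apply: dvdz_mull].
Qed.

Lemma horner_bound (q : {poly int}) (x : nat) : (0 < x)%N ->
  (`|q.[x%:Z]| <= (\sum_(i < size q) `|(q`_i)%R|) * x ^ size q)%N.
Proof.
move=> x0; rewrite horner_coef.
apply: (@leq_trans (\sum_(i < size q) `|(q`_i * x%:Z ^+ i)%R|)).
  elim/big_ind2: _ => // a b c d h1 h2.
  by lia.
rewrite big_distrl /=; apply: leq_sum => i _.
by rewrite abszM abszX leq_mul2l leq_pexp2l ?orbT // ltnW.
Qed.

Lemma poly_eq0_on_tail (R : idomainType) (f : nat -> R) (q : {poly R}) n0 :
  injective f -> (forall n, (n0 <= n)%N -> q.[f n] = 0) -> q = 0.
Proof.
move=> injf hq; apply/eqP/negPn/negP => q0.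
pose rs := [seq f i | i <- iota n0 (size q)].
have root_rs : all (root q) rs.
  by apply/allP => x /mapP[i]; rewrite mem_iota => /andP[h _] ->; apply/eqP/hq.
have uniq_rs : uniq rs by rewrite map_inj_uniq // iota_uniq.
by have := max_poly_roots q0 root_rs uniq_rs; rewrite size_map size_iota ltnn.
Qed.

Definition laurent (s : nat -> rat) : Prop :=
  exists (p : {poly rat}) (k : nat),
    forall n, s n = p.[(approx n)%:R] / (approx n)%:R ^+ k.

Lemma approx_neq0 n : (approx n)%:R != 0 :> rat.
Proof. exact/odd_rat_neq0/approx_odd. Qed.

Lemma laurent_int s : laurent s -> exists (q : {poly int}) (d : int) (k : nat),
  d != 0 /\ forall n,
    s n * d%:~R * (approx n ^ k)%N%:R = (q.[(approx n)%:Z])%:~R.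
Proof.
move=> [p [k hs]]; have [q [d d0 ep]] := rat_poly_scale p.
exists q, d, k; split => // n; rewrite hs ep hornerZ.
rewrite [(approx n)%:R]pmulrn horner_map -pmulrn natrX.
by rewrite mulrAC divfK ?expf_neq0 ?approx_neq0 // mulrC mulVKf ?intr_eq0.
Qed.

Lemma leq_approxX n : (n <= approx n ^ n)%N.
Proof.
case: n => // n; apply: leq_trans (ltnW (approx_gt _)) _.
by rewrite -{1}[approx _]expn1 leq_pexp2l // approx_gt0.
Qed.

Lemma pow2_dvd_intP N (k : int) : pow2_dvd N k <-> ((2 ^ N)%N%:Z %| k)%Z.
Proof.
split=> [[d ->]|/dvdzP[d ->]].
  by rewrite -mulr_natr natz dvdz_mull.
by exists d; rewrite -mulr_natr natz.
Qed.

(** Clearing denominators, [s m - s n] becomes a difference of values of integer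
    polynomials, divisible by [approx m - approx n]; the denominator [d] costs
    [v] digits and the powers of [approx] cost none, being odd. *)
Lemma cauchy_laurent s : laurent s -> cauchy2 s.
Proof.
move=> /laurent_int[q [d [k [d0 hs]]]] N; have [v hv] := close_mulz d0.
exists (N + v)%N.
suff H m n : (n <= m)%N -> (N + v <= n)%N -> close N (s m - s n).
  move=> m n lm ln; case: (leqP n m) => h; first exact: H.
  by rewrite -opprB; apply/closeN/H => //; apply: ltnW.
move=> lenm len; apply: hv.
have oX i : odd (approx i ^ k) by rewrite oddX approx_odd orbT.
apply/(close_oddM _ _ (oX m))/(close_oddM _ _ (oX n)).
pose x := (approx m)%:Z; pose y := (approx n)%:Z.
have -> : (s m - s n) * d%:~R * (approx m ^ k)%:R * (approx n ^ k)%:R =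
   (q.[x] * (approx n ^ k)%N%:Z - q.[y] * (approx m ^ k)%N%:Z)%:~R.
  rewrite rmorphB !rmorphM /= -!hs -!pmulrn; ring.
apply: (@closeW (approx n ^ n)); first exact: leq_trans len (leq_approxX n).
apply/close_intP/pow2_dvd_intP.
have -> : q.[x] * (approx n ^ k)%N%:Z - q.[y] * (approx m ^ k)%N%:Z =
  (q.[x] - q.[y]) * y ^+ k - q.[y] * (('X^k).[x] - ('X^k).[y]).
  by rewrite !hornerXn -!natz !natrX /x /y -!natz; ring.
by apply: rpredB; [apply: dvdz_mulr|apply: dvdz_mull];
  apply: horner_dvd; apply: approx_dvd.
Qed.

(** Transcendence of t: a Laurent polynomial in t that vanishes is zero.  With
    [E = approx n ^ n], the integer [q.[approx n]] is divisible by [2 ^ E],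
    since [q.[approx m]] is for large [m] and the two are congruent; but for
    large [n] it is smaller than [2 ^ E], so [approx n] is a root of [q]. *)
Lemma laurent_separated s :
  laurent s -> (forall N, near_close N s) -> forall n, s n = 0.
Proof.
move=> /laurent_int[q [d [k [d0 hs]]]] h.
suff q0 : q = 0.
  move=> n; have /eqP := hs n; rewrite q0 horner0 !mulf_eq0 intr_eq0 (negbTE d0).
  by rewrite orbF pnatr_eq0 expn_eq0 eqn0Ngt approx_gt0 orbF => /eqP.
pose B := (\sum_(i < size q) `|(q`_i)%R|)%N.
apply: (@poly_eq0_on_tail _ (fun n => (approx n)%:Z) q (B + (size q).+1)%N).
  by move=> m n [] /(incn_inj approx_mono).
move=> n len; set E := (approx n ^ n)%N.
have [m0 hm] := h E; pose m := (m0 + n)%N.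
have dm : ((2 ^ E)%N%:Z %| q.[(approx m)%:Z])%Z.
  apply/pow2_dvd_intP/close_intP; rewrite -hs pmulrn.
  by apply/closeZ/closeZ/hm; rewrite leq_addr.
have dmn := horner_dvd q (approx_dvd (leq_addl m0 n)).
have : ((2 ^ E)%N%:Z %| q.[(approx n)%:Z])%Z.
  by rewrite -(subKr q.[(approx m)%:Z] q.[(approx n)%:Z]) rpredB.
rewrite dvdzE /= => dn; apply/eqP; rewrite -absz_eq0 -leqn0 leqNgt.
apply/negP => q0; have := dvdn_leq q0 dn; rewrite leqNgt => /negP; apply.
apply: leq_ltn_trans (horner_bound q (approx_gt0 n)) _; rewrite -/B.
apply: leq_ltn_trans (ltn_expl E (isT : (1 < 2)%N)).
apply: (@leq_trans (approx n ^ (size q).+1)).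
  rewrite expnS leq_mul2r; apply/orP; right.
  by have := approx_gt n; lia.
rewrite leq_pexp2l ?approx_gt0 //; lia.
Qed.

(** * Polynomials and Laurent polynomials in t *)

Lemma laurentB r s : laurent r -> laurent s -> laurent (r - s).
Proof.
move=> [p [k hr]] [q [l hs]].
exists (p * 'X^l - q * 'X^k), (k + l)%N => n.
have := approx_neq0 n; rewrite -[(r - s) n]/(r n - s n) hr hs !hornerE.
move: (approx n)%:R => x x0; rewrite exprD.
field; by rewrite !expf_neq0.
Qed.

Lemma laurentZ q s : laurent s -> laurent (fun n => q * s n).
Proof.
by move=> [p [k hs]]; exists (q *: p), k => n; rewrite hs hornerZ mulrA.
Qed.

Lemma laurentM r s : laurent r -> laurent s -> laurent (fun n => r n * s n).
Proof.
move=> [p [k hr]] [q [l hs]]; exists (p * q), (k + l)%N => n.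
by rewrite hr hs hornerM exprD invfM mulrACA.
Qed.

Definition polynomial (s : nat -> rat) : Prop :=
  exists p : {poly rat}, forall n, s n = p.[(approx n)%:R].

Lemma polynomial_laurent s : polynomial s -> laurent s.
Proof. by move=> [p hp]; exists p, 0%N => n; rewrite expr0 divr1. Qed.

Lemma polynomialB r s : polynomial r -> polynomial s -> polynomial (r - s).
Proof.
move=> [p hr] [q hs]; exists (p - q) => n.
by rewrite -[(r - s) n]/(r n - s n) hr hs !hornerE.
Qed.

Lemma polynomialZ q s : polynomial s -> polynomial (fun n => q * s n).
Proof. by move=> [p hs]; exists (q *: p) => n; rewrite hs hornerZ. Qed.

Lemma polynomialX k : polynomial (fun n => (approx n ^ k)%N%:R).
Proof. by exists 'X^k => n; rewrite hornerXn natrX. Qed.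

Lemma polynomial1 : polynomial (fun=> 1).
Proof. by exists 1 => n; rewrite hornerE. Qed.

Definition laurent_space : cauchy_space :=
  CauchySpace laurentB laurentZ (polynomial_laurent polynomial1) cauchy_laurent.

Definition polynomial_space : cauchy_space :=
  CauchySpace polynomialB polynomialZ polynomial1
    (fun s h => cauchy_laurent (polynomial_laurent h)).

Lemma ip_comb W k (a : k.-tuple (integral_part W)) z n :
  (comb a z) n = \sum_i tnth a i n * (z i)%:~R.
Proof.
rewrite /comb.
rewrite (big_morph (fun s : integral_part W => s n) (id1 := 0) (op1 := +%R)) //.
by apply: eq_bigr => i _; rewrite ip_mulrz.
Qed.

Lemma ip_dvdB W N (r s : integral_part W) (c : int) :
  pow2_dvd N (r - s *~ c) <-> near_close N (fun n => r n - s n * c%:~R).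
Proof.
rewrite ip_dvdP.
have -> // : (r - s *~ c : nat -> rat) = (fun n => r n - s n * c%:~R).
by apply/funext => n; rewrite -ip_mulrz.
Qed.

(** Multiplication by the unit t ^ K is invertible on 2-adic numbers, so it
    keeps linear relations, and it keeps valuations: the coordinates of [a] over
    the generator 1 are those of [b] over the generator t ^ K. *)
Lemma tp_mul_monomial (W W' : cauchy_space) K k
    (a : k.-tuple (integral_part W)) (b : k.-tuple (integral_part W')) :
  W' (fun n => (approx n ^ K)%N%:R) ->
  (forall i n, tnth b i n = tnth a i n * (approx n ^ K)%N%:R) ->
  @tp _ (additive_structure (integral_part W)) _ a =
  @tp _ (additive_structure (integral_part W')) _ b.
Proof.
move=> WK ab; have dW := dyadic_integral_part W.
apply: tp_eq_agree => //; first exact: dyadic_integral_part.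
move=> N; split.
  move=> z _; have combE n : (comb b z) n = (comb a z) n * (approx n ^ K)%N%:R.
    rewrite !ip_comb mulr_suml; apply: eq_bigr => i _.
    by rewrite ab mulrAC.
  split=> h; apply: ipP => n; first by rewrite combE h mul0r.
  have /eqP := combE n; rewrite h eq_sym mulf_eq0 natrX expf_eq0.
  by rewrite (negbTE (approx_neq0 n)) andbF orbF => /eqP.
have [e he] : exists e : integral_part W, forall n, e n = 1.
  by apply: ip_exists (cs_one W) _; exists 0%N => n _; apply: (close_int 1).
have [f hf] : exists f : integral_part W', forall n, f n = (approx n ^ K)%N%:R.
  by apply: ip_exists WK _; exists 0%N => n _; rewrite pmulrn; apply: close_int.
have oddK n : odd (approx n ^ K) by rewrite oddX approx_odd orbT.
have ne : ~ pow2_dvd 1 e.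
  move=> /ip_dvdP[n0 /(_ n0 (leqnn _))]; rewrite he; exact: not_close1.
have nf : ~ pow2_dvd 1 f.
  move=> /ip_dvdP[n0 /(_ n0 (leqnn _))]; rewrite hf -[_%:R]mul1r.
  by move/(close_oddM _ _ (oddK n0)); apply: not_close1.
have [c hc] := choice (fun i => dyadic_residue dW ne (tnth a i) N).
exists e, f, c; split => // i; split => //.
apply/ip_dvdB; have /ip_dvdB[n0 h] := hc i; exists n0 => n /h.
rewrite ab hf he mul1r => h'.
rewrite [X in _ - X]mulrC -mulrBl.
by apply/(close_oddM _ _ (oddK n)).
Qed.

(** Towards Laurent polynomials the inclusion (K = 0) preserves types; in the
    other direction K is the largest pole order among the entries. *)
Lemma isotypic_polynomial_laurent :
  isotypic (additive_structure (integral_part polynomial_space))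
           (additive_structure (integral_part laurent_space)).
Proof.
have X_laurent K : laurent_space (fun n => (approx n ^ K)%N%:R).
  exact/polynomial_laurent/polynomialX.
have X_polynomial K : polynomial_space (fun n => (approx n ^ K)%N%:R).
  exact: polynomialX.
split=> k.
- move=> a.
  have /choice[g hg] (s : integral_part polynomial_space) :
      exists r : integral_part laurent_space, forall n, r n = s n.
    apply: (@ip_exists laurent_space) (ip_integral s).
    exact: polynomial_laurent (ip_mem s).
  exists (map_tuple g a : k.-tuple _).
  apply: (@tp_mul_monomial polynomial_space laurent_space 0) => // i n.
  by rewrite tnth_map hg mulr1.
- move=> b.
  have /choice[d hd] (s : integral_part laurent_space) : exists K : nat,
      forall L, (K <= L)%N -> polynomial (fun n => s n * (approx n ^ L)%N%:R).
    have [p [K hK]] := ip_mem s; exists K => L /subnK eL.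
    exists (p * 'X^(L - K)) => n.
    rewrite hK hornerM hornerXn -{1}eL natrX.
    by rewrite exprD mulrCA divfK ?expf_neq0 ?approx_neq0 // mulrC.
  pose K := (\max_(i < k) d (tnth b i))%N.
  have hb (i : 'I_k) : exists r : integral_part polynomial_space,
      forall n, r n = tnth b i n * (approx n ^ K)%N%:R.
    apply: ip_exists; first exact/hd/(leq_bigmax i).
    have [n0 h] := ip_integral (tnth b i).
    by exists n0 => n /h hn; rewrite (pmulrn (1 : rat)); apply: closeZ.
  have [g hg] := choice hb.
  exists ([tuple g i | i < k] : k.-tuple _); apply/esym.
  apply: (@tp_mul_monomial laurent_space polynomial_space K) => // i n.
  by rewrite tnth_mktuple hg.
Qed.

(** Write s = c + 2^N x with c an integer: then phi s and s * phi 1 are both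
    congruent to c * phi 1 modulo 2^N, for every N, so they coincide because
    the valuation is separated on Laurent polynomials in t. *)
Lemma hom_is_scaling (W W' : cauchy_space)
    (phi : integral_part W -> integral_part W') (e : integral_part W) :
  (forall s, W s -> laurent s) -> (forall s, W' s -> laurent s) ->
  {morph phi : r s / r + s} -> (forall n, e n = 1) ->
  forall s n, phi s n = s n * phi e n.
Proof.
move=> Wl Wl' phiD he s.
have phi0 : phi 0 = 0.
  by apply: (addrI (phi 0)); rewrite -phiD !addr0.
have phiMn r m : phi (r *+ m) = phi r *+ m.
  by elim: m => [|m IH]; rewrite ?mulr0n // !mulrS phiD IH.
have phiN r : phi (- r) = - phi r.
  by apply/eqP; rewrite -addr_eq0 -phiD addNr phi0.
have phiMz r (c : int) : phi (r *~ c) = phi r *~ c.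
  by case: c => m; rewrite ?NegzE ?mulrNz ?phiN -?pmulrn phiMn.
have ne : ~ pow2_dvd 1 e.
  move=> /ip_dvdP[n0 /(_ n0 (leqnn _))]; rewrite he; exact: not_close1.
pose D := (phi s : nat -> rat) - (fun n => s n * phi e n).
suff D0 : forall n, D n = 0.
  by move=> n; apply/eqP; rewrite -subr_eq0; apply/eqP; apply: D0.
apply: laurent_separated => [|N].
  apply: laurentB; first exact/Wl'/ip_mem.
  by apply: laurentM; [exact/Wl/ip_mem|exact/Wl'/ip_mem].
have [c [x hx]] := dyadic_residue (dyadic_integral_part W) ne s N.
have hs : s = x *+ (2 ^ N) + e *~ c by rewrite -hx subrK.
have /ip_dvdB h1 : pow2_dvd N (phi s - phi e *~ c).
  by exists (phi x); rewrite {1}hs phiD phiMn phiMz addrK.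
have /ip_dvdB h2 : pow2_dvd N (s - e *~ c) by exists x.
have := near_closeM h2 (ip_integral (phi e)).
rewrite addn0 => /(near_closeB h1); congr near_close; apply/funext => n.
rewrite /D -![(_ - _) n]/(_ n - _ n) /= he; ring.
Qed.

(** An isomorphism would be a scaling by c = phi 1.  As t is a unit, c / t lies
    in the target, so it is c * p(t) for a polynomial p, whence p * 'X = 1. *)
Lemma not_isomorphic_polynomial_laurent :
  ~ isomorphic_groups
      (GRing.to_multiplicative (integral_part polynomial_space))
      (GRing.to_multiplicative (integral_part laurent_space)).
Proof.
move=> [phi phi_bij].
pose f (s : integral_part polynomial_space) : integral_part laurent_space := phi s.
have fD : {morph f : r s / r + s} by move=> r s; apply: (@gmulfM _ _ phi).
have [g gK fK] := phi_bij.
have [e he] : exists e : integral_part polynomial_space, forall n, e n = 1.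
  by apply: (@ip_exists polynomial_space) polynomial1 _; exists 0%N => n _;
    apply: (close_int 1).
have scal := @hom_is_scaling polynomial_space laurent_space f e
  polynomial_laurent (fun s => id) fD he.
have [r hr] : exists r : integral_part laurent_space,
    forall n, r n = (approx n)%:R^-1 * f e n.
  apply: ip_exists.
    apply: laurentM (ip_mem (f e)); exists 1, 1%N => n.
    by rewrite expr1 hornerE mul1r.
  have [n0 h] := ip_integral (f e); exists n0 => n /h hn.
  by apply/(close_oddM _ _ (approx_odd n)); rewrite mulrC mulVKf ?approx_neq0.
pose s : integral_part polynomial_space := g r.
have [p hp] := ip_mem s.
have [q [k hq]] := ip_mem (f e).
have pq : (p * 'X - 1) * q = 0.
  apply: (@poly_eq0_on_tail _ (fun n => (approx n)%:R) _ 0).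
    by move=> m n /eqP; rewrite eqr_nat => /eqP/(incn_inj approx_mono).
  move=> n _; have x0 := approx_neq0 n.
  have : f s n = r n by rewrite /f /s fK.
  rewrite scal hp hr hq => h; rewrite !hornerE.
  move: h x0; move: (approx n)%:R => x h x0.
  have xk0 : x ^+ k != 0 by rewrite expf_neq0.
  apply: (mulIf (invr_neq0 xk0)); rewrite mul0r.
  have -> : (p.[x] * x - 1) * q.[x] / x ^+ k =
     x * (p.[x] * (q.[x] / x ^+ k) - x^-1 * (q.[x] / x ^+ k)).
    by field; rewrite xk0 x0.
  by rewrite h subrr mulr0.
move/eqP: pq; rewrite mulf_eq0 => /orP[|/eqP q0].
  rewrite subr_eq0 => /eqP/(congr1 (fun p => p.[0])).
  by rewrite !hornerE => /eqP; rewrite eq_sym oner_eq0.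
have fe0 : f e = f 0.
  have -> : f 0 = 0 by apply: (addrI (f 0)); rewrite -fD !addr0.
  by apply: ipP => n; rewrite hq q0 horner0 mul0r.
have e0 : e = 0 by rewrite -[e]gK -[0]gK; congr g.
have := he 0%N; rewrite e0 => /eqP; by rewrite eq_sym oner_eq0.
Qed.

Lemma countable_integral_part (W : cauchy_space) :
  (forall s, W s -> laurent s) -> countable [set: integral_part W]%classic.
Proof.
move=> Wl.
have /choice[g hg] (s : integral_part W) : exists pk : {poly rat} * nat,
    forall n, s n = pk.1.[(approx n)%:R] / (approx n)%:R ^+ pk.2.
  by have [p [k h]] := Wl _ (ip_mem s); exists (p, k).
apply/countable_injP; exists (fun s => pickle (g s)) => r s _ _.
move=> /(pcan_inj (@pickleK _)) e.
by apply: ipP => n; rewrite !hg e.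
Qed.

(** * Two countable isotypic groups that are not isomorphic *)

Theorem theorem4p2 :
  exists G H : groupType,
    countable [set: G]%classic /\ countable [set: H]%classic /\
    isotypic (group_structure G) (group_structure H) /\
    ~ isomorphic_groups G H.
Proof.
exists (GRing.to_multiplicative (integral_part polynomial_space)).
exists (GRing.to_multiplicative (integral_part laurent_space)).
split; first exact/(@countable_integral_part polynomial_space)/polynomial_laurent.
split; first exact: (@countable_integral_part laurent_space).
split; first exact: isotypic_polynomial_laurent.
exact: not_isomorphic_polynomial_laurent.
Qed.
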